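(* For $\ell\in\mathbb{N}$, let $r_{2\ell}$ be the unique zero of the Bernoulli polynomial $B_{2\ell}(s)$ on $\bigl(0,\frac12\bigr)$. For all $m,\ell\in\mathbb{N}_0$ with $m<\ell$, the ratio $(-1)^{\ell-m}\frac{B_{2m}(s)}{B_{2\ell}(s)}$ decreases in $s\in(0,r_{2\ell})$ and decreases in $s\in\bigl(r_{2\ell},\frac12\bigr)$, while it increases in $s\in\bigl(\frac12,1-r_{2\ell}\bigr)$ and increases in $s\in(1-r_{2\ell},1)$.
   Context: $\mathbb{N}=\{1,2,\dots\}$ and $\mathbb{N}_0=\{0\}\cup\mathbb{N}$. The Bernoulli polynomials $B_\ell(s)$, $\ell\in\mathbb{N}_0$, are defined by $\frac{z e^{sz}}{e^z-1}=\sum_{\ell=0}^\infty B_\ell(s)\frac{z^\ell}{\ell!}$ for $|z|<2\pi$. It is known (Ostrowski) that for each $\ell\in\mathbb{N}$ the polynomial $B_{2\ell}(s)$ has exactly one real zero on $\bigl(0,\frac12\bigr)$. *)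

(* Defs.v *)
From Stdlib Require Import Reals Factorial.
From Coquelicot Require Import Coquelicot.
Open Scope R_scope.

(* Coquelicot has no exponential on [C]: exp (x + i y) = e^x (cos y + i sin y). *)
Definition Cexp (z : C) : C :=
  (exp (fst z) * cos (snd z), exp (fst z) * sin (snd z)).

(* [B l s] is the value at [s] of the [l]-th Bernoulli polynomial.  The
   equation is required for every real [s], which determines [B] uniquely.
   The point z = 0 is excluded because the generating function has a removable
   singularity there (with total division it would evaluate to 0, while the
   series has value B_0(s) = 1). *)
Definition bernoulli_polynomials (B : nat -> R -> R) : Prop :=
  forall (s : R) (z : C), 0 < Cmod z < 2 * PI ->
    is_series (fun l : nat => (B l s * (z ^ l / INR (fact l)))%C)
              (z * Cexp (s * z) / (Cexp z - 1))%C.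

Definition unique_zero_in (f : R -> R) (a b r : R) : Prop :=
  unique (fun x => a < x < b /\ f x = 0) r.

Definition increasing_on (f : R -> R) (a b : R) : Prop :=
  forall x y, a < x -> x < y -> y < b -> f x < f y.

Definition decreasing_on (f : R -> R) (a b : R) : Prop :=
  forall x y, a < x -> x < y -> y < b -> f y < f x.

(* Main.v *)
Require Import Defs.
From Stdlib Require Import Reals Lra Lia Factorial.
From Coquelicot Require Import Coquelicot.
Open Scope R_scope.

(* With [e_n = B_n / n!] one has [e_(n+1)' = e_n]; put [f_n = (-1)^n e_(2n)] and
   [h_n = (-1)^(n+1) e_(2n+1)], so that [f_(n+1)' = h_n], [h_n' = - f_n] and
   [h_(n+1)'' = - h_n].  On (0, 1/2) each [h_n] is positive, and it vanishes at
   both ends (except [h_0] at 0).  By induction, with a mean-value argument on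
   [h_n - c h_(n+1)], each [h_n / h_(n+1)] strictly decreases, hence so does
   [h_m / h_l] for m < l.

   At the zero r of [f_l] on (0, 1/2) the function [h_l] is maximal, which forces
   [f_m r >= 0].  Since [f_m' / f_l'] decreases, comparing [f_m] and [f_l] on the
   interval between r and s gives [f_m' f_l - f_m f_l' < 0] at every s <> r; so
   [f_m / f_l] decreases on either side of r.  The reflection s -> 1 - s yields
   the right half. *)

(** * Bernoulli polynomials from their generating function *)

(** The real part is additive and continuous, so it commutes with partial sums and their limit. *)
Lemma is_series_Re (a : nat -> C) (z : C) :
  is_series a z -> is_series (fun n => Re (a n)) (Re z).
Proof.
  intros H.
  apply (filterlim_ext (fun n => Re (sum_n a n))).
  - intros n; induction n as [|n IH].
    + now rewrite !sum_O.
    + now rewrite !sum_Sn, <- IH.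
  - destruct z as [x y].
    eapply filterlim_comp; [exact H|].
    exact (continuous_fst x y).
Qed.

(** Beyond the radius of convergence the terms do not tend to 0. *)
Lemma CV_radius_ge (a : nat -> R) (x v : R) :
  is_pseries a x v -> Rbar_le (Rabs x) (CV_radius a).
Proof.
  intros H; apply Rbar_not_lt_le; intros Hlt.
  apply (CV_disk_outside a x Hlt).
  apply ex_series_lim_0; exists v; now apply is_pseries_R.
Qed.

(* Multiplying both series by the variable makes them agree at [0] as well. *)
Lemma pseries_unique_punctured (a b : nat -> R) (F : R -> R) :
  (forall x, 0 < Rabs x < 1 -> is_pseries a x (F x)) ->
  (forall x, 0 < Rabs x < 1 -> is_pseries b x (F x)) ->
  forall n, a n = b n.
Proof.
  intros Ha Hb n.
  assert (Hr : forall c, (forall x, 0 < Rabs x < 1 -> is_pseries c x (F x)) ->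
    Rbar_lt 0 (CV_radius (PS_incr_1 c))).
  { intros c Hc; rewrite CV_radius_incr_1.
    assert (Hh : Rabs (1 / 2) = 1 / 2) by (apply Rabs_pos_eq; lra).
    apply Rbar_lt_le_trans with (Rabs (1 / 2)).
    - rewrite Hh; simpl; lra.
    - apply (CV_radius_ge c _ (F (1 / 2))), Hc; rewrite Hh; lra. }
  apply (PSeries_ext_recip (PS_incr_1 a) (PS_incr_1 b) (S n)); auto.
  exists (mkposreal 1 Rlt_0_1); intros x Hx.
  change (Rabs (x - 0) < 1) in Hx; rewrite Rminus_0_r in Hx.
  rewrite !PSeries_incr_1.
  destruct (Req_dec x 0) as [->|Hx0]; [now rewrite !Rmult_0_l|].
  assert (H : 0 < Rabs x < 1) by (split; [now apply Rabs_pos_lt|easy]).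
  now rewrite (is_pseries_unique _ _ _ (Ha x H)), (is_pseries_unique _ _ _ (Hb x H)).
Qed.

Lemma is_pseries_series (a u : nat -> R) (x v : R) :
  (forall n, u n = a n * x ^ n) -> is_series u v -> is_pseries a x v.
Proof.
  intros Hu H; apply is_pseries_R; now apply (is_series_ext u).
Qed.

Lemma is_pseries_exp_scal (s x : R) :
  is_pseries (fun n => s ^ n / INR (fact n)) x (exp (s * x)).
Proof.
  apply (is_pseries_series _ (fun n => / INR (fact n) * (s * x) ^ n)).
  - intros n; rewrite Rpow_mult_distr; unfold Rdiv; ring.
  - apply is_pseries_R, is_exp_Reals.
Qed.

Lemma exp_minus_1_neq_0 (x : R) : x <> 0 -> exp x - 1 <> 0.
Proof.
  intros Hx H; apply Hx, exp_inv; rewrite exp_0; lra.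
Qed.

Definition bern (B : nat -> R -> R) (n : nat) (s : R) : R :=
  B n s / INR (fact n).

(** At real [x] the generating function is real, so real parts suffice. Allowing [|x| = 1] shows
    that the radius of convergence is at least 1, as the product of series at [|x| < 1] requires. *)
Lemma is_pseries_bern (B : nat -> R -> R) (s x : R) :
  bernoulli_polynomials B -> 0 < Rabs x <= 1 ->
  is_pseries (fun n => bern B n s) x (x * exp (s * x) / (exp x - 1)).
Proof.
  intros hB Hx.
  assert (Hx0 : x <> 0) by (intros ->; rewrite Rabs_R0 in Hx; lra).
  assert (He := exp_minus_1_neq_0 x Hx0).
  assert (Hz : 0 < Cmod x < 2 * PI).
  { rewrite Cmod_R. assert (H := PI2_1). lra. }
  assert (HC : forall t : R, Cexp t = RtoC (exp t)).
  { intros t; unfold Cexp, RtoC; simpl; rewrite cos_0, sin_0.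
    f_equal; ring. }
  assert (H := is_series_Re _ _ (hB s x Hz)).
  rewrite <- RtoC_mult, !HC, <- RtoC_minus, <- RtoC_mult, <- RtoC_div in H by easy.
  refine (is_pseries_series _ _ _ _ _ H); intros n.
  rewrite <- RtoC_pow, <- RtoC_div, <- RtoC_mult by apply INR_fact_neq_0.
  unfold bern; simpl; unfold Rdiv; ring.
Qed.

(** The generating function at [s] is the one at 0 times [exp (s * x)]; compare coefficients with
    the Cauchy product. *)
Lemma bern_Appell (B : nat -> R -> R) (s : R) (n : nat) :
  bernoulli_polynomials B ->
  bern B n s =
  sum_n (fun k => bern B k 0 * (s ^ (n - k) / INR (fact (n - k)))) n.
Proof.
  intros hB; rewrite sum_n_Reals.
  apply (pseries_unique_punctured (fun n => bern B n s)
    (PS_mult (fun n => bern B n 0) (fun n => s ^ n / INR (fact n)))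
    (fun x => x * exp (s * x) / (exp x - 1))); intros x Hx.
  - apply is_pseries_bern; [easy|lra].
  - assert (Hx0 : x <> 0) by (intros ->; rewrite Rabs_R0 in Hx; lra).
    assert (He := exp_minus_1_neq_0 x Hx0).
    assert (Hr : forall a v, is_pseries a 1 v -> Rbar_lt (Rabs x) (CV_radius a)).
    { intros a v H; apply Rbar_lt_le_trans with (Rabs 1).
      - rewrite Rabs_R1; simpl; lra.
      - now apply CV_radius_ge with v. }
    replace (x * exp (s * x) / (exp x - 1))
      with (x * exp (0 * x) / (exp x - 1) * exp (s * x))
      by (rewrite Rmult_0_l, exp_0; field; easy).
    apply is_pseries_mult.
    + apply is_pseries_bern; [easy|lra].
    + apply is_pseries_exp_scal.
    + eapply Hr, is_pseries_bern; [easy|rewrite Rabs_R1; lra].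
    + eapply Hr, is_pseries_exp_scal.
Qed.

Lemma is_derive_bern (B : nat -> R -> R) (n : nat) (s : R) :
  bernoulli_polynomials B ->
  is_derive (bern B (S n)) s (bern B n s).
Proof.
  intros hB.
  apply (is_derive_ext (fun t => sum_n (fun k => bern B k 0 *
    (t ^ (S n - k) / INR (fact (S n - k)))) (S n))).
  { intros t; symmetry; now apply bern_Appell. }
  (* The term [k = S n] is constant in [t]; without the case split, truncated subtraction would give
     [bern B k 0] there instead of 0. *)
  set (d := fun k => if Nat.eqb k (S n) then 0 else
    bern B k 0 * (s ^ (n - k) / INR (fact (n - k)))).
  replace (bern B n s) with (sum_n d (S n)).
  - apply (is_derive_sum_n (fun k t => bern B k 0 *
      (t ^ (S n - k) / INR (fact (S n - k))))); intros k Hk; unfold d.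
    destruct (Nat.eqb_spec k (S n)) as [->|Hne].
    + rewrite Nat.sub_diag; simpl. auto_derive; [easy|ring].
    + replace (S n - k)%nat with (S (n - k)) by lia.
      assert (H := INR_fact_neq_0 (n - k)).
      assert (H' := not_0_INR (S (n - k)) ltac:(lia)).
      rewrite fact_simpl, mult_INR.
      auto_derive; [easy|].
      simpl Init.Nat.pred; field; easy.
  - rewrite sum_Sn, (bern_Appell B s n hB).
    replace (d (S n)) with (@zero R_AbelianMonoid)
      by (unfold d; now rewrite Nat.eqb_refl).
    rewrite plus_zero_r.
    apply sum_n_ext_loc; intros k Hk; unfold d.
    destruct (Nat.eqb_spec k (S n)); [lia|easy].
Qed.

(** The generating function is unchanged under [(s, x) -> (1 - s, - x)]. *)
Lemma bern_reflect (B : nat -> R -> R) (n : nat) (s : R) :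
  bernoulli_polynomials B ->
  bern B n (1 - s) = (-1) ^ n * bern B n s.
Proof.
  intros hB.
  apply (pseries_unique_punctured (fun n => bern B n (1 - s))
    (fun n => (-1) ^ n * bern B n s)
    (fun x => x * exp ((1 - s) * x) / (exp x - 1))); intros x Hx.
  - apply is_pseries_bern; [easy|lra].
  - assert (Hx0 : x <> 0) by (intros ->; rewrite Rabs_R0 in Hx; lra).
    assert (He := exp_minus_1_neq_0 x Hx0).
    assert (He' := exp_minus_1_neq_0 (- x) ltac:(lra)).
    assert (H : is_pseries (fun n => bern B n s) (- x)
      (- x * exp (s * - x) / (exp (- x) - 1)))
      by (apply is_pseries_bern; [easy|rewrite Rabs_Ropp; lra]).
    replace (x * exp ((1 - s) * x) / (exp x - 1))
      with (- x * exp (s * - x) / (exp (- x) - 1)).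
    + apply is_pseries_R in H.
      refine (is_pseries_series _ _ _ _ _ H); intros k. replace (- x) with (-1 * x) by ring.
      rewrite Rpow_mult_distr; ring.
    + replace ((1 - s) * x) with (x + s * - x) by ring.
      rewrite exp_plus, exp_Ropp in *.
      assert (Hp := exp_pos x).
      field; repeat split; try easy; lra.
Qed.

(** The generating functions at 1 and 0 differ by [x (exp x - 1) / (exp x - 1) = x]. *)
Lemma bern_1_minus_0 (B : nat -> R -> R) (n : nat) :
  bernoulli_polynomials B ->
  bern B n 1 - bern B n 0 = if Nat.eqb n 1 then 1 else 0.
Proof.
  intros hB.
  apply (pseries_unique_punctured (fun n => bern B n 1 - bern B n 0)
    (fun n => if Nat.eqb n 1 then 1 else 0) (fun x => x)); intros x Hx.
  - assert (Hx0 : x <> 0) by (intros ->; rewrite Rabs_R0 in Hx; lra).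
    assert (He := exp_minus_1_neq_0 x Hx0).
    assert (H : forall s, is_pseries (fun n => bern B n s) x
      (x * exp (s * x) / (exp x - 1))) by (intros s; apply is_pseries_bern; [easy|lra]).
    assert (Hd := is_pseries_minus _ _ _ _ _ (H 1) (H 0)).
    replace (plus _ _) with x in Hd; [exact Hd|].
    change (x = x * exp (1 * x) / (exp x - 1) + - (x * exp (0 * x) / (exp x - 1))).
    rewrite Rmult_1_l, Rmult_0_l, exp_0; now field.
  - apply is_pseries_R.
    refine (is_lim_seq_ext_loc (fun _ => x) _ x _ (is_lim_seq_const x)).
    exists 1%nat; intros k Hk.
    induction Hk as [|k Hk IH].
    + rewrite sum_Sn, sum_O; unfold plus; simpl; ring.
    + rewrite sum_Sn, <- IH; destruct k; [lia|].
      simpl; unfold plus; simpl; ring.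
Qed.

(** The Appell sum makes [bern B 1] affine with slope [bern B 0 0]; its increment from 0 to 1 gives
    the slope, and reflection gives the constant term. *)
Lemma bern_0_1 (B : nat -> R -> R) (s : R) :
  bernoulli_polynomials B -> bern B 0 s = 1 /\ bern B 1 s = s - 1 / 2.
Proof.
  intros hB.
  assert (H0 : forall t, bern B 0 t = bern B 0 0).
  { intros t; rewrite (bern_Appell B t 0 hB), sum_O; simpl; field. }
  assert (H1 : forall t, bern B 1 t = bern B 0 0 * t + bern B 1 0).
  { intros t; rewrite (bern_Appell B t 1 hB), sum_Sn, sum_O.
    unfold plus; simpl; field. }
  assert (Hd := bern_1_minus_0 B 1 hB).
  assert (Hr := bern_reflect B 1 0 hB).
  rewrite Rminus_0_r in Hr. simpl in Hd, Hr.
  rewrite H0, H1; rewrite (H1 1) in Hd, Hr.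
  split; [lra|]. replace (bern B 0 0) with 1 by lra. lra.
Qed.

(** * Quotients of Bernoulli polynomials on (0, 1/2) *)

(* The signs make [bern_odd] positive on (0, 1/2) and [bern_even (S n)]
   increasing there. *)
Definition bern_even (B : nat -> R -> R) (n : nat) (s : R) : R :=
  (-1) ^ n * bern B (2 * n) s.

Definition bern_odd (B : nat -> R -> R) (n : nat) (s : R) : R :=
  (-1) ^ S n * bern B (S (2 * n)) s.

(** [bern_even B 0] is the constant 1; the separate case lets one derivative formula serve every
    [n]. *)
Definition Dbern_even (B : nat -> R -> R) (n : nat) (s : R) : R :=
  match n with O => 0 | S k => bern_odd B k s end.

Lemma is_derive_bern_even (B : nat -> R -> R) (n : nat) (s : R) :
  bernoulli_polynomials B ->
  is_derive (bern_even B n) s (Dbern_even B n s).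
Proof.
  intros hB; destruct n as [|n].
  - apply (is_derive_ext (fun _ => 1)).
    + intros t; unfold bern_even; destruct (bern_0_1 B t hB) as [H _].
      simpl; rewrite H; ring.
    + apply (is_derive_const 1 s).
  - unfold bern_even; replace (2 * S n)%nat with (S (S (2 * n))) by lia.
    apply (is_derive_scal (bern B (S (S (2 * n))))); now apply is_derive_bern.
Qed.

Lemma is_derive_bern_odd (B : nat -> R -> R) (n : nat) (s : R) :
  bernoulli_polynomials B ->
  is_derive (bern_odd B n) s (- bern_even B n s).
Proof.
  intros hB; unfold bern_odd, bern_even.
  replace (- ((-1) ^ n * bern B (2 * n) s))
    with ((-1) ^ S n * bern B (2 * n) s) by (simpl; ring).
  apply (is_derive_scal (bern B (S (2 * n)))); now apply is_derive_bern.
Qed.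

(** At the fixed point of the reflection an odd-index value is its own negative. *)
Lemma bern_odd_half (B : nat -> R -> R) (n : nat) :
  bernoulli_polynomials B -> bern_odd B n (1 / 2) = 0.
Proof.
  intros hB; unfold bern_odd.
  assert (H := bern_reflect B (S (2 * n)) (1 / 2) hB).
  rewrite pow_1_odd in H; replace (1 - 1 / 2) with (1 / 2) in H by field.
  replace (bern B (S (2 * n)) (1 / 2)) with 0 by lra; ring.
Qed.

(** Reflection makes the values at 0 and 1 opposite, while for an index other than 1 they are
    equal. *)
Lemma bern_odd_0 (B : nat -> R -> R) (n : nat) :
  bernoulli_polynomials B -> bern_odd B (S n) 0 = 0.
Proof.
  intros hB; unfold bern_odd.
  assert (H := bern_reflect B (S (2 * S n)) 0 hB).
  assert (H' := bern_1_minus_0 B (S (2 * S n)) hB).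
  rewrite pow_1_odd, Rminus_0_r in H.
  replace (Nat.eqb (S (2 * S n)) 1) with false in H'
    by (symmetry; apply Nat.eqb_neq; lia).
  replace (bern B (S (2 * S n)) 0) with 0 by lra; ring.
Qed.

Lemma bern_odd_O (B : nat -> R -> R) (s : R) :
  bernoulli_polynomials B -> bern_odd B 0 s = 1 / 2 - s.
Proof.
  intros hB; destruct (bern_0_1 B s hB) as [_ H].
  unfold bern_odd; simpl; rewrite H; ring.
Qed.

(** * Mean-value arguments for the odd-index polynomials *)

Lemma MVT_is_derive (f df : R -> R) (a b : R) :
  a < b -> (forall x, a <= x <= b -> is_derive f x (df x)) ->
  exists c, a < c < b /\ f b - f a = df c * (b - a).
Proof.
  intros Hab Hd.
  destruct (MVT_cor2 f df a b Hab) as [c [Hc1 Hc2]].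
  - intros c Hc; now apply is_derive_Reals, Hd.
  - now exists c.
Qed.

(** The non-strict forms accept the negation of a strict inequality as it stands, which suits proofs
    by contradiction. *)
Lemma MVT_ge_0 (f df : R -> R) (a b : R) :
  a < b -> (forall x, a <= x <= b -> is_derive f x (df x)) ->
  f a <= f b -> exists c, a < c < b /\ 0 <= df c.
Proof.
  intros Hab Hd Hf; destruct (MVT_is_derive f df a b Hab Hd) as [c [Hc E]].
  exists c; split; [easy|nra].
Qed.

Lemma MVT_le_0 (f df : R -> R) (a b : R) :
  a < b -> (forall x, a <= x <= b -> is_derive f x (df x)) ->
  f b <= f a -> exists c, a < c < b /\ df c <= 0.
Proof.
  intros Hab Hd Hf; destruct (MVT_is_derive f df a b Hab Hd) as [c [Hc E]].
  exists c; split; [easy|nra].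
Qed.

(** A value [<= 0] of [bern_odd (n+1)], which vanishes at both ends, would make [bern_even (n+1)] be
    [>= 0] at some point and [<= 0] further right, although its derivative [bern_odd n] is
    positive. *)
Lemma bern_odd_pos (B : nat -> R -> R) (n : nat) (s : R) :
  bernoulli_polynomials B -> 0 < s < 1 / 2 -> 0 < bern_odd B n s.
Proof.
  intros hB; revert s; induction n as [|n IH]; intros s Hs.
  - rewrite bern_odd_O by easy; lra.
  - apply Rnot_le_lt; intros Hle.
    assert (Hd := fun t => is_derive_bern_odd B (S n) t hB).
    destruct (MVT_le_0 _ (fun t => - bern_even B (S n) t) 0 s ltac:(lra) ltac:(auto))
      as [x [Hx Ex]]; [now rewrite bern_odd_0|].
    destruct (MVT_ge_0 _ (fun t => - bern_even B (S n) t) s (1 / 2) ltac:(lra) ltac:(auto))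
      as [y [Hy Ey]]; [now rewrite bern_odd_half|].
    destruct (MVT_le_0 (bern_even B (S n)) (bern_odd B n) x y ltac:(lra))
      as [z [Hz Ez]]; [|lra|].
    + intros t _; now apply (is_derive_bern_even B (S n)).
    + assert (H := IH z ltac:(lra)); lra.
Qed.

(* [u = bern_odd n - c * bern_odd (n+1)] with [u s1 = 0] satisfies
   [u 0 >= 0 = u s1 <= u s2 >= 0 = u (1/2)], so
   [u'' = c * bern_odd n - bern_odd (n-1)] takes a value [>= 0] and, further
   right, a value [<= 0]. *)
Lemma bern_odd_quot_witness (B : nat -> R -> R) (n : nat) (s1 s2 : R) :
  bernoulli_polynomials B -> 0 < s1 -> s1 < s2 -> s2 < 1 / 2 ->
  bern_odd B n s1 / bern_odd B (S n) s1 <= bern_odd B n s2 / bern_odd B (S n) s2 ->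
  exists c y1 y2, 0 < c /\ 0 < y1 /\ y1 < y2 /\ y2 < 1 / 2 /\
    Dbern_even B n y1 <= c * bern_odd B n y1 /\
    c * bern_odd B n y2 <= Dbern_even B n y2.
Proof.
  intros hB H1 H12 H2 Hle.
  assert (Hp : forall k s, 0 < s < 1 / 2 -> 0 < bern_odd B k s)
    by (intros; now apply bern_odd_pos).
  assert (P1 := Hp n s1 ltac:(lra)); assert (Q1 := Hp (S n) s1 ltac:(lra)).
  assert (Q2 := Hp (S n) s2 ltac:(lra)).
  set (c := bern_odd B n s1 / bern_odd B (S n) s1) in *.
  set (u := fun t => bern_odd B n t - c * bern_odd B (S n) t).
  set (du := fun t => - bern_even B n t - c * - bern_even B (S n) t).
  set (ddu := fun t => - Dbern_even B n t - c * - bern_odd B n t).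
  assert (Du : forall t, is_derive u t (du t)).
  { intros t; apply (is_derive_minus (bern_odd B n)).
    - now apply is_derive_bern_odd.
    - apply is_derive_scal; now apply is_derive_bern_odd. }
  assert (Ddu : forall t, is_derive du t (ddu t)).
  { intros t; apply (is_derive_minus (fun t => - bern_even B n t)).
    - apply (is_derive_opp (bern_even B n)); now apply is_derive_bern_even.
    - apply is_derive_scal.
      apply (is_derive_opp (bern_even B (S n))); now apply (is_derive_bern_even B (S n)). }
  assert (U0 : 0 <= u 0).
  { unfold u; rewrite bern_odd_0 by easy.
    destruct n; [rewrite bern_odd_O by easy|rewrite bern_odd_0 by easy]; lra. }
  assert (U1 : u s1 = 0) by (unfold u, c; field; lra).
  assert (U2 : 0 <= u s2).
  { unfold u; apply (Rmult_le_compat_r (bern_odd B (S n) s2)) in Hle; [|lra].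
    replace (bern_odd B n s2 / bern_odd B (S n) s2 * bern_odd B (S n) s2)
      with (bern_odd B n s2) in Hle by (field; lra).
    lra. }
  assert (U3 : u (1 / 2) = 0) by (unfold u; rewrite !bern_odd_half by easy; ring).
  destruct (MVT_le_0 u du 0 s1) as [x1 [X1 E1]]; [lra|auto|lra|].
  destruct (MVT_ge_0 u du s1 s2) as [x2 [X2 E2]]; [lra|auto|lra|].
  destruct (MVT_le_0 u du s2 (1 / 2)) as [x3 [X3 E3]]; [lra|auto|lra|].
  destruct (MVT_ge_0 du ddu x1 x2) as [y1 [Y1 F1]]; [lra|auto|lra|].
  destruct (MVT_le_0 du ddu x2 x3) as [y2 [Y2 F2]]; [lra|auto|lra|].
  exists c, y1, y2; unfold ddu in F1, F2.
  split; [now apply Rdiv_lt_0_compat|lra].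
Qed.

(** A failure at [n + 1] yields, through the witness, a failure at [n] between [y1] and [y2]. For
    [n = 0] the witness contradicts [bern_odd 0 > 0] directly. *)
Lemma bern_odd_quot_step (B : nat -> R -> R) (n : nat) (s1 s2 : R) :
  bernoulli_polynomials B -> 0 < s1 -> s1 < s2 -> s2 < 1 / 2 ->
  bern_odd B n s2 / bern_odd B (S n) s2 < bern_odd B n s1 / bern_odd B (S n) s1.
Proof.
  intros hB; revert s1 s2; induction n as [|n IH]; intros s1 s2 H1 H12 H2;
    apply Rnot_le_lt; intros Hle;
    destruct (bern_odd_quot_witness B _ s1 s2 hB H1 H12 H2 Hle)
      as (c & y1 & y2 & Hc & Y1 & Y12 & Y2 & E1 & E2); simpl in E1, E2.
  - assert (P := bern_odd_pos B 0 y2 hB ltac:(lra)); nra.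
  - assert (P1 := bern_odd_pos B (S n) y1 hB ltac:(lra)).
    assert (P2 := bern_odd_pos B (S n) y2 hB ltac:(lra)).
    assert (H := IH y1 y2 Y1 Y12 Y2).
    apply Rle_div_l in E1; [|easy]; apply Rle_div_r in E2; [|easy]; lra.
Qed.

(** The quotient telescopes into consecutive ones, all positive and decreasing. *)
Lemma bern_odd_quot_decreasing (B : nat -> R -> R) (m l : nat) :
  bernoulli_polynomials B -> (m < l)%nat ->
  decreasing_on (fun s => bern_odd B m s / bern_odd B l s) 0 (1 / 2).
Proof.
  intros hB Hml s1 s2 H1 H12 H2.
  induction Hml as [|l Hml IH]; [now apply bern_odd_quot_step|].
  assert (Hs := bern_odd_quot_step B l s1 s2 hB H1 H12 H2).
  assert (Hp : forall k s, 0 < s < 1 / 2 -> 0 < bern_odd B k s)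
    by (intros; now apply bern_odd_pos).
  assert (E : forall s, 0 < s < 1 / 2 -> bern_odd B m s / bern_odd B (S l) s =
    bern_odd B m s / bern_odd B l s * (bern_odd B l s / bern_odd B (S l) s)).
  { intros s Hs'; assert (P := Hp l s Hs'); assert (Q := Hp (S l) s Hs').
    field; lra. }
  rewrite !E by lra.
  apply Rmult_gt_0_lt_compat; try easy; apply Rdiv_lt_0_compat; apply Hp; lra.
Qed.

(** * Even-index quotients on either side of the zero *)

Lemma bern_even_increasing (B : nat -> R -> R) (n : nat) (s1 s2 : R) :
  bernoulli_polynomials B -> 0 <= s1 -> s1 < s2 -> s2 <= 1 / 2 ->
  bern_even B (S n) s1 < bern_even B (S n) s2.
Proof.
  intros hB H1 H12 H2; apply Rnot_le_lt; intros Hle.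
  destruct (MVT_le_0 (bern_even B (S n)) (bern_odd B n) s1 s2 H12) as [c [Hc E]];
    [intros t _; now apply (is_derive_bern_even B (S n))|easy|].
  assert (P := bern_odd_pos B n c hB ltac:(lra)); lra.
Qed.

(* [r] maximises [bern_odd l]; were [bern_even m r] negative, [bern_odd m] would
   increase to the right of [r], and so would the quotient. *)
Lemma bern_even_ge_0_at_zero (B : nat -> R -> R) (m l : nat) (r : R) :
  bernoulli_polynomials B -> (m < l)%nat -> 0 < r < 1 / 2 ->
  bern_even B (S l) r = 0 -> 0 <= bern_even B (S m) r.
Proof.
  intros hB Hml Hr H0; apply Rnot_lt_le; intros Hneg.
  assert (Hc : continuous (bern_even B (S m)) r)
    by (apply (ex_derive_continuous (bern_even B (S m))); eexists;
      now apply is_derive_bern_even).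
  destruct (Hc _ (open_lt 0 _ Hneg)) as [eps Heps].
  assert (He := cond_pos eps).
  (* Close enough to [r] that [bern_even (m+1)] stays negative on [[r, s]], and still below 1/2. *)
  set (s := r + Rmin (eps / 2) ((1 / 2 - r) / 2)).
  assert (Hs : r < s < 1 / 2 /\ s < r + eps).
  { assert (G1 := Rmin_l (eps / 2) ((1 / 2 - r) / 2)).
    assert (G2 := Rmin_r (eps / 2) ((1 / 2 - r) / 2)).
    assert (G3 := Rmin_pos (eps / 2) ((1 / 2 - r) / 2) ltac:(lra) ltac:(lra)).
    unfold s; lra. }
  assert (Hd := fun k t => is_derive_bern_odd B k t hB).
  assert (Hm : bern_odd B (S m) r < bern_odd B (S m) s).
  { apply Rnot_le_lt; intros Hle.
    destruct (MVT_le_0 (bern_odd B (S m)) (fun t => - bern_even B (S m) t) r s)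
      as [c [C E]]; [lra|auto|easy|].
    assert (Hb : bern_even B (S m) c < 0); [|lra].
    apply Heps; change (Rabs (c - r) < eps); rewrite Rabs_pos_eq; lra. }
  assert (Hl : bern_odd B (S l) s < bern_odd B (S l) r).
  { apply Rnot_le_lt; intros Hle.
    destruct (MVT_ge_0 (bern_odd B (S l)) (fun t => - bern_even B (S l) t) r s)
      as [c [C E]]; [lra|auto|easy|].
    assert (H := bern_even_increasing B l r c hB ltac:(lra) ltac:(lra) ltac:(lra)); lra. }
  assert (Hq := bern_odd_quot_decreasing B (S m) (S l) hB ltac:(lia) r s
    ltac:(lra) ltac:(lra) ltac:(lra)); simpl in Hq.
  assert (P1 := bern_odd_pos B (S m) r hB ltac:(lra)).
  assert (P2 := bern_odd_pos B (S l) s hB ltac:(lra)).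
  apply (Rlt_irrefl (bern_odd B (S m) r / bern_odd B (S l) r)).
  apply Rlt_trans with (2 := Hq).
  apply Rmult_le_0_lt_compat; try lra.
  - left; apply Rinv_0_lt_compat; lra.
  - apply Rinv_lt_contravar; [nra|easy].
Qed.

(** This is the numerator of the derivative of [bern_even m / bern_even (l+1)]. For [m > 0] it
    equals [- bern_odd l s * u s], where [u = bern_even m - c * bern_even (l+1)] and [c] makes
    [u' s = 0]. The claim is then [u s > u r >= 0]. *)
Lemma bern_wronskian_neg (B : nat -> R -> R) (m l : nat) (r s : R) :
  bernoulli_polynomials B -> (m <= l)%nat -> 0 < r < 1 / 2 ->
  bern_even B (S l) r = 0 -> 0 < s < 1 / 2 -> s <> r ->
  Dbern_even B m s * bern_even B (S l) s - bern_even B m s * bern_odd B l s < 0.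
Proof.
  intros hB Hml Hr H0 Hs Hsr.
  assert (Pl : forall t, 0 < t < 1 / 2 -> 0 < bern_odd B l t)
    by (intros; now apply bern_odd_pos).
  assert (Ps := Pl s Hs).
  (* For [m = 0] the numerator reduces to [- bern_odd l s]. *)
  destruct m as [|m]; simpl.
  { unfold bern_even at 2; destruct (bern_0_1 B s hB) as [E _]; simpl; rewrite E; lra. }
  assert (Hm := bern_even_ge_0_at_zero B m l r hB Hml Hr H0).
  set (c := bern_odd B m s / bern_odd B l s).
  set (u := fun t => bern_even B (S m) t - c * bern_even B (S l) t).
  set (du := fun t => bern_odd B m t - c * bern_odd B l t).
  assert (Du : forall t, is_derive u t (du t)).
  { intros t; apply (is_derive_minus (bern_even B (S m))).
    - now apply (is_derive_bern_even B (S m)).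
    - apply is_derive_scal; now apply (is_derive_bern_even B (S l)). }
  assert (Hu : u r < u s).
  (* Since the quotient of derivatives decreases through [c] at [s], [u] rises before [s] and falls
     after it. *)
  { assert (E : forall t, 0 < t < 1 / 2 ->
      du t = bern_odd B l t * (bern_odd B m t / bern_odd B l t - c)).
    { intros t Ht; assert (P := Pl t Ht); unfold du; field; lra. }
    assert (Hq := bern_odd_quot_decreasing B m l hB Hml).
    apply Rnot_le_lt; intros Hle.
    destruct (Rdichotomy _ _ Hsr) as [Hlt|Hlt].
    - destruct (MVT_ge_0 u du s r) as [x [Hx Ex]]; [lra|auto|lra|].
      rewrite E in Ex by lra.
      assert (Q := Hq s x ltac:(lra) ltac:(lra) ltac:(lra)); simpl in Q; fold c in Q.
      assert (P := Pl x ltac:(lra)); nra.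
    - destruct (MVT_le_0 u du r s) as [x [Hx Ex]]; [lra|auto|lra|].
      rewrite E in Ex by lra.
      assert (Q := Hq x s ltac:(lra) ltac:(lra) ltac:(lra)); simpl in Q; fold c in Q.
      assert (P := Pl x ltac:(lra)); nra. }
  replace (bern_odd B m s) with (c * bern_odd B l s) by (unfold c; field; lra).
  unfold u in Hu; rewrite H0 in Hu; nra.
Qed.

(** The condition [~ (a < r < b)] treats both sides of the zero at once: [[x, y]] misses [r], so the
    denominator, being strictly monotone, does not vanish there. *)
Lemma bern_even_quot_decreasing (B : nat -> R -> R) (m l : nat) (r a b : R) :
  bernoulli_polynomials B -> (m <= l)%nat -> 0 < r < 1 / 2 ->
  bern_even B (S l) r = 0 -> 0 <= a -> b <= 1 / 2 -> ~ (a < r < b) ->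
  decreasing_on (fun s => bern_even B m s / bern_even B (S l) s) a b.
Proof.
  intros hB Hml Hr H0 Ha Hb Hnr x y Hx Hxy Hy.
  assert (Hne : forall t, x <= t <= y -> t <> r /\ bern_even B (S l) t <> 0).
  { intros t Ht; assert (Htr : t <> r) by (intros ->; lra).
    split; [easy|].
    destruct (Rdichotomy _ _ Htr) as [Hlt|Hlt].
    - assert (H := bern_even_increasing B l t r hB ltac:(lra) Hlt ltac:(lra)); lra.
    - assert (H := bern_even_increasing B l r t hB ltac:(lra) Hlt ltac:(lra)); lra. }
  apply Rnot_le_lt; intros Hle.
  destruct (MVT_ge_0 (fun s => bern_even B m s / bern_even B (S l) s)
    (fun s => (Dbern_even B m s * bern_even B (S l) s
      - bern_even B m s * bern_odd B l s) / bern_even B (S l) s ^ 2) x y Hxy)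
    as [z [Hz Ez]].
  - intros t Ht; destruct (Hne t Ht) as [_ H].
    apply (is_derive_div (bern_even B m) (bern_even B (S l))); [| |easy].
    + now apply is_derive_bern_even.
    + now apply (is_derive_bern_even B (S l)).
  - exact Hle.
  - destruct (Hne z ltac:(lra)) as [Hzr H].
    assert (W := bern_wronskian_neg B m l r z hB Hml Hr H0 ltac:(lra) Hzr).
    assert (P : 0 < / bern_even B (S l) z ^ 2)
      by (apply Rinv_0_lt_compat, pow2_gt_0, H).
    unfold Rdiv in Ez; nra.
Qed.

(** * Return to the original polynomials and reflection *)

Lemma B_reflect (B : nat -> R -> R) (n : nat) (s : R) :
  bernoulli_polynomials B -> B n (1 - s) = (-1) ^ n * B n s.
Proof.
  intros hB; assert (H := bern_reflect B n s hB); unfold bern in H.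
  assert (Hf := INR_fact_neq_0 n).
  apply (Rmult_eq_reg_r (/ INR (fact n))); [|now apply Rinv_neq_0_compat].
  unfold Rdiv in H; rewrite H; ring.
Qed.

Lemma pow_m1_sqr (n : nat) : (-1) ^ n * (-1) ^ n = 1.
Proof.
  rewrite <- Rpow_mult_distr; replace (-1 * -1) with 1 by ring; apply pow1.
Qed.

Lemma B_bern_even (B : nat -> R -> R) (n : nat) (s : R) :
  B (2 * n)%nat s = (-1) ^ n * INR (fact (2 * n)) * bern_even B n s.
Proof.
  assert (Hf := INR_fact_neq_0 (2 * n)).
  unfold bern_even, bern.
  replace (_ * _ * _) with ((-1) ^ n * (-1) ^ n * B (2 * n)%nat s) by (field; easy).
  rewrite pow_m1_sqr; ring.
Qed.

Theorem theorem4p2 (B : nat -> R -> R) (hB : bernoulli_polynomials B)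
  (m l : nat) (hml : (m < l)%nat)
  (r : R) (hr : unique_zero_in (B (2 * l)%nat) 0 (1 / 2) r) :
  let ratio := fun s : R =>
    (-1) ^ (l - m) * (B (2 * m)%nat s / B (2 * l)%nat s) in
  decreasing_on ratio 0 r /\
  decreasing_on ratio r (1 / 2) /\
  increasing_on ratio (1 / 2) (1 - r) /\
  increasing_on ratio (1 - r) 1.
Proof.
  intros ratio.
  destruct hr as [[Hr Hz] _].
  destruct l as [|l]; [lia|].
  assert (Hsgn0 : forall n, (-1) ^ n <> 0) by (intros n; apply pow_nonzero; lra).
  assert (Hz' : bern_even B (S l) r = 0).
  { rewrite B_bern_even in Hz.
    apply Rmult_integral in Hz as [Hz|Hz]; [|easy].
    apply Rmult_integral in Hz as [Hz|Hz]; [now apply Hsgn0 in Hz|].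
    now apply INR_fact_neq_0 in Hz. }
  set (K := INR (fact (2 * m)) / INR (fact (2 * S l))).
  assert (HK : 0 < K) by (apply Rdiv_lt_0_compat; apply INR_fact_lt_0).
  (* The factor [(-1) ^ (l - m)] cancels exactly the signs built into [bern_even], leaving a
     positive constant. *)
  assert (E : forall s, ratio s = K * (bern_even B m s / bern_even B (S l) s)).
  { intros s; unfold ratio, K; rewrite !B_bern_even.
    unfold Rdiv; rewrite !Rinv_mult, <- pow_inv.
    replace (/ -1) with (-1) by field.
    replace ((-1) ^ S l) with ((-1) ^ (S l - m) * (-1) ^ m)
      by (rewrite <- pow_add; f_equal; lia).
    transitivity (((-1) ^ (S l - m) * (-1) ^ (S l - m)) * ((-1) ^ m * (-1) ^ m) *
      (INR (fact (2 * m)) * / INR (fact (2 * S l)) *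
      (bern_even B m s * / bern_even B (S l) s))); [ring|].
    rewrite !pow_m1_sqr; ring. }
  assert (Hdec : forall a b, 0 <= a -> b <= 1 / 2 -> ~ (a < r < b) ->
    decreasing_on ratio a b).
  { intros a b Ha Hb Hab x y Hx Hxy Hy; rewrite !E.
    apply Rmult_lt_compat_l; [easy|].
    now apply (bern_even_quot_decreasing B m l r a b hB ltac:(lia) Hr Hz'). }
  assert (Hrefl : forall s, ratio (1 - s) = ratio s).
  { intros s; unfold ratio; rewrite !B_reflect, !pow_1_even, !Rmult_1_l by easy.
    reflexivity. }
  (* Both indices are even, so [ratio] is symmetric about 1/2, and reflecting an interval reverses
     monotonicity. *)
  assert (Hinc : forall a b, decreasing_on ratio a b ->
    increasing_on ratio (1 - b) (1 - a)).
  { intros a b H x y Hx Hxy Hy; rewrite <- (Hrefl x), <- (Hrefl y).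
    apply H; lra. }
  assert (D1 := Hdec 0 r ltac:(lra) ltac:(lra) ltac:(lra)).
  assert (D2 := Hdec r (1 / 2) ltac:(lra) ltac:(lra) ltac:(lra)).
  repeat split; [easy|easy| |].
  - replace (1 / 2) with (1 - 1 / 2) by field; now apply Hinc.
  - replace 1 with (1 - 0) at 2 by ring; now apply Hinc.
Qed.
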